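(* Let $\mathcal{L}=\{M_j=(E_j,\mathcal{I}_j):j\in[m]\}$ be a collection of matroids with $E=\bigcup_jE_j$, such that every element of $E$ belongs to exactly $p$ of the sets $E_j$ and no element is a loop of any local matroid containing it. Consider the linear program (the occurrence LP) in variables $y\in\mathbb{R}^E$, $\xi\in\mathbb{R}^V$ that maximizes $\sum_{e\in E}w_ey_e$ subject to $$\sum_{v\in S}\xi_v\le r_{\widehat M}(S)\ \ \forall S\subseteq V,\qquad \xi_{j,e}=y_e\ \ \forall (j,e)\in V,\qquad \xi_{j,e}\ge0\ \ \forall (j,e)\in V,\qquad y_e\ge0\ \ \forall e\in E.$$ Then: (1) The projection of the feasible region of the occurrence LP onto the $y$-coordinates is exactly $P_{\mathcal{L}}$. (2) The integral feasible solutions correspond as well: the projections onto the $y$-coordinates of the integral feasible solutions of the occurrence LP are exactly the incidence vectors $\mathbf{1}_I$ with $I\in\mathcal{F}_{\mathcal{L}}$. (3) Consequently, for every weight vector $w\in\mathbb{R}^E$, the fractional optimum values of the occurrence LP and of $\max\{w\cdot x:x\in P_{\mathcal{L}}\}$ agree, the integral optimum values of the two formulations agree, and hence the two formulations have the same integrality gap.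
   Context: $[m]=\{1,\ldots,m\}$; all sets are finite. For the collection $\mathcal{L}$, the feasible sets are $\mathcal{F}_{\mathcal{L}}=\{I\subseteq E: I\cap E_j\in\mathcal{I}_j\ \text{for every } j\in[m]\}$. For a matroid $M$ on $E'$ with rank function $r_M$, $P(M)=\{y\in\mathbb{R}_{\ge0}^{E'}:\sum_{e\in S}y_e\le r_M(S)\ \forall S\subseteq E'\}$ is its independent set polytope, and $$P_{\mathcal{L}}=\{x\in[0,1]^E: x|_{E_j}\in P(M_j)\ \text{for every } j\in[m]\}.$$ Let $V_j=\{(j,e):e\in E_j\}$ and let $V$ be the disjoint union of $V_1,\ldots,V_m$ (the occurrence ground set). Let $\widehat M_j$ be the copy of $M_j$ on $V_j$ (identifying $(j,e)$ with $e$), and let $\widehat M=\bigoplus_{j=1}^m\widehat M_j$ be the direct-sum matroid on $V$, with rank function $r_{\widehat M}$. The integrality gap of a formulation is the worst-case ratio between its fractional and integral optimum values. *)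

(* Defs.v *)
From HB Require Import structures.
From mathcomp Require Import all_boot all_order all_algebra.
From mathcomp Require Import all_classical all_reals ereal.

Set Implicit Arguments.
Unset Strict Implicit.
Unset Printing Implicit Defensive.

Import Order.TTheory GRing.Theory Num.Theory.

Local Open Scope ring_scope.

Record matroid (T : finType) := Matroid {
  indep : {set {set T}};
  indep0 : finset.set0 \in indep;
  indep_sub : forall I J : {set T},
    I \subset J -> J \in indep -> I \in indep;
  indep_aug : forall I J : {set T},
    I \in indep -> J \in indep -> (#|I| < #|J|)%N ->
    exists2 e, e \in (J :\: I)%SET & (e |: I)%SET \in indep }.

Definition loop (T : finType) (M : matroid T) (e : T) : bool :=
  ([set e]%SET) \notin indep M.

Definition rank (T : finType) (M : matroid T) (S : {set T}) : nat :=
  (\max_(I in indep M | I \subset S) #|I|)%N.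

Definition indep_polytope (R : realType) (T : finType) (M : matroid T) :
    set {ffun T -> R} :=
  [set y : {ffun T -> R} | (forall e, 0 <= y e) /\
           (forall S : {set T}, \sum_(e in S) y e <= (rank M S)%:R)]%classic.

Arguments indep_polytope R {T} M.

(* The summands are matroids on the fibers T_ j; the ground set is the tagged
   union of the fibers, whose j-th component carries the copy of M j. *)
Section DirectSum.
Variables (J : finType) (T_ : J -> finType) (M : forall j, matroid (T_ j)).

Definition slice (j : J) (A : {set {j : J & T_ j}}) : {set T_ j} :=
  [set e | Tagged T_ e \in A]%SET.

Definition direct_sum_indep : {set {set {j : J & T_ j}}} :=
  [set A : {set {j : J & T_ j}} | [forall j, slice j A \in indep (M j)]]%SET.

Lemma direct_sum_indep0 : finset.set0 \in direct_sum_indep.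
Proof.
rewrite inE; apply/forallP => j.
suff -> : slice j finset.set0 = finset.set0 by exact: indep0.
by apply/setP => e; rewrite !inE.
Qed.

Lemma slice_sub j (A B : {set {j : J & T_ j}}) :
  A \subset B -> slice j A \subset slice j B.
Proof.
move=> /fintype.subsetP sAB; apply/fintype.subsetP => e.
by rewrite !inE => /sAB.
Qed.

Lemma direct_sum_indep_sub (A B : {set {j : J & T_ j}}) :
  A \subset B -> B \in direct_sum_indep -> A \in direct_sum_indep.
Proof.
move=> sAB; rewrite !inE => /forallP iB; apply/forallP => j.
exact: indep_sub (slice_sub j sAB) (iB j).
Qed.

Lemma Tagged_inj j : injective (Tagged T_ (i := j)).
Proof. by move=> e f /eqP; rewrite eq_Tagged => /eqP. Qed.

Lemma card_slices (A : {set {j : J & T_ j}}) :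
  #|A| = (\sum_j #|slice j A|)%N.
Proof.
rewrite -sum1_card (partition_big (fun v => tag v) predT) //=.
apply: eq_bigr => j _; rewrite sum1dep_card -(card_imset _ (@Tagged_inj j)).
apply: eq_card => v; rewrite !inE; apply/idP/imsetP.
  by case: v => i e /= /andP[eA /eqP eij]; subst i; exists e; rewrite ?inE.
by case=> e; rewrite inE => eA ->; rewrite eA /= eqxx.
Qed.

Lemma direct_sum_indep_aug (A B : {set {j : J & T_ j}}) :
  A \in direct_sum_indep -> B \in direct_sum_indep -> (#|A| < #|B|)%N ->
  exists2 v, v \in (B :\: A)%SET & (v |: A)%SET \in direct_sum_indep.
Proof.
rewrite !inE => /forallP iA /forallP iB ltAB.
have [j ltj] : exists j, (#|slice j A| < #|slice j B|)%N.
  apply/existsP; apply: contraLR ltAB; rewrite negb_exists => /forallP leBA.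
  by rewrite -leqNgt !card_slices leq_sum // => j _; rewrite leqNgt.
have [e eBA ieA] := indep_aug (iA j) (iB j) ltj.
exists (Tagged T_ e); first by move: eBA; rewrite !inE.
rewrite inE; apply/forallP => i; have [eij|neij] := eqVneq i j.
  subst i; suff -> : slice j (Tagged T_ e |: A)%SET = (e |: slice j A)%SET by [].
  by apply/setP => f; rewrite !inE eq_Tagged.
suff -> : slice i (Tagged T_ e |: A)%SET = slice i A by [].
apply/setP => f; rewrite !inE; case: eqP => // /(congr1 tag) /= eij.
by rewrite eij eqxx in neij.
Qed.

Definition direct_sum : matroid {j : J & T_ j} :=
  Matroid direct_sum_indep0 direct_sum_indep_sub direct_sum_indep_aug.

End DirectSum.

Section Collections.
Variables (E : finType) (m : nat) (G : 'I_m -> {set E}).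

(* A local matroid lives on the subtype of elements of its ground set G j, so
   that I :&: G j is represented by its trace on that subtype. *)
Definition local_ground (j : 'I_m) : finType := {e : E | e \in G j}.

Definition trace (j : 'I_m) (I : {set E}) : {set local_ground j} :=
  [set e | val e \in I]%SET.

Definition restriction (R : realType) (j : 'I_m) (x : {ffun E -> R}) :
    {ffun local_ground j -> R} :=
  [ffun e => x (val e)].

Definition occurrence : finType := {j : 'I_m & local_ground j}.

Definition occ_elt (v : occurrence) : E := val (tagged v).

Variable M : forall j, matroid (local_ground j).

Definition feasible_sets : {set {set E}} :=
  [set I : {set E} | [forall j, trace j I \in indep (M j)]]%SET.

Definition occurrence_matroid : matroid occurrence := direct_sum M.

Variable R : realType.

Definition incidence (I : {set E}) : {ffun E -> R} := [ffun e => (e \in I)%:R].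

Definition collection_polytope : set {ffun E -> R} :=
  [set x : {ffun E -> R} | (forall e, 0 <= x e <= 1) /\
           (forall j, indep_polytope R (M j) (restriction j x))]%classic.

Definition occurrence_region : set ({ffun E -> R} * {ffun occurrence -> R}) :=
  [set z : {ffun E -> R} * {ffun occurrence -> R} |
           [/\ forall S : {set occurrence},
                \sum_(v in S) z.2 v <= (rank occurrence_matroid S)%:R,
              forall v, z.2 v = z.1 (occ_elt v),
              forall v, 0 <= z.2 v
            & forall e, 0 <= z.1 e]]%classic.

End Collections.
Arguments collection_polytope {E m G} M R.
Arguments occurrence_region {E m G} M R.

Definition integral_vector (R : realType) (T : finType) : set {ffun T -> R} :=
  [set x : {ffun T -> R} | forall e, x e \is a Num.int]%classic.

Definition dot (R : realType) (E : finType) (w x : {ffun E -> R}) : R :=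
  \sum_e w e * x e.

Record formulation (R : realType) (E : finType) := Formulation {
  solution : Type;
  feasible : set solution;
  integral : set solution;
  objective : {ffun E -> R} -> solution -> R }.
Arguments feasible {R E} f.
Arguments integral {R E} f.
Arguments objective {R E} f w z.

Section Optima.
Variables (R : realType) (E : finType) (F : formulation R E).
Implicit Type w : {ffun E -> R}.

(* Optima are suprema in \bar R, so that no junk value arises for an empty or
   unbounded region; they are the maxima whenever these are attained. *)
Definition frac_opt w : \bar R :=
  ereal_sup [set (objective F w z)%:E | z in feasible F]%classic.

Definition int_opt w : \bar R :=
  ereal_sup [set (objective F w z)%:E | z in feasible F `&` integral F]%classic.

(* The condition on w only discards the indeterminate ratio 0 / 0 (when 0 is
   an integral feasible value, both optima are nonnegative); a positive
   fractional optimum over a zero integral one counts as +oo, since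
   0^-1 = +oo in \bar R. *)
Definition integrality_gap : \bar R :=
  ereal_sup [set (frac_opt w / int_opt w)%E | w in
               [set w | (0 < frac_opt w)%E]]%classic.

End Optima.

Section Formulations.
Variables (R : realType) (E : finType) (m : nat) (G : 'I_m -> {set E}).
Variable M : forall j, matroid (local_ground G j).

Definition polytope_formulation : formulation R E :=
  {| solution := {ffun E -> R};
     feasible := collection_polytope M R;
     integral := @integral_vector R E;
     objective := fun w x => dot w x |}.

Definition occurrence_LP : formulation R E :=
  {| solution := {ffun E -> R} * {ffun occurrence G -> R};
     feasible := occurrence_region M R;
     integral := [set z | integral_vector z.1 /\ integral_vector z.2]%classic;
     objective := fun w z => dot w z.1 |}.

End Formulations.

(* Main.v *)
Require Import Defs.
From mathcomp Require Import all_boot all_order all_algebra.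
From mathcomp Require Import all_classical all_reals ereal.

Set Implicit Arguments.
Unset Strict Implicit.
Unset Printing Implicit Defensive.

Import Order.TTheory GRing.Theory Num.Theory.
Local Open Scope ring_scope.

(** The occurrence LP asks for a point [xi] of the independent set polytope of
    the direct sum of the local matroids whose coordinates agree on all copies
    of an element, so that [xi] is the vector [spread y] obtained by copying
    each [y e] to the occurrences of [e].  The rank of a direct sum is the sum
    of the ranks of the slices ([rank_direct_sum]), hence its independent set
    polytope is the product of the polytopes of the summands
    ([indep_polytope_direct_sum]).  Since the [j]-th component of [spread y] is
    the restriction of [y] to the [j]-th ground set, feasibility of
    [(y, spread y)] says exactly that all restrictions of [y] lie in the local
    polytopes ([occurrence_regionP]); the upper bounds [y e <= 1] come for free
    because every element has an occurrence and singletons have rank at most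
    one.

    For integral points, the bounds [0 <= y e <= 1] leave only 0/1 vectors, and the
    incidence vector of [I] lies in an independent set polytope exactly when
    [I] is independent ([incidence_indep_polytope]: test the constraint on [I]
    itself).  Hence both formulations have the incidence vectors of feasible
    sets as integral points.  Finally, the objective of the occurrence LP only
    reads [y], so its optima are suprema over the projections, which are the
    feasible and integral feasible regions of the other formulation. *)

(** * Rank and independence *)

Section Rank.
Variables (T : finType) (M : matroid T).

Lemma card_le_rank (I S : {set T}) :
  I \in indep M -> I \subset S -> (#|I| <= rank M S)%N.
Proof.
move=> iI sIS; rewrite /rank.
by apply: (bigop.bigmax_sup I); rewrite ?iI.
Qed.

Lemma rank_basis (S : {set T}) :
  exists I : {set T}, [/\ I \in indep M, I \subset S & #|I| = rank M S].
Proof.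
pose P (I : {set T}) := (I \in indep M) && (I \subset S).
have P0 : P finset.set0 by rewrite /P indep0 finset.sub0set.
rewrite /rank -/(P _) (bigop.bigmax_eq_arg finset.set0 P0).
by case: arg_maxnP => // I /andP[iI sIS] _; exists I.
Qed.

Lemma rank_le_card (S : {set T}) : (rank M S <= #|S|)%N.
Proof. by have [I [_ sIS <-]] := rank_basis S; exact: subset_leq_card. Qed.

Lemma indep_card_rank (S : {set T}) : (#|S| <= rank M S)%N -> S \in indep M.
Proof.
have [I [iI sIS <-]] := rank_basis S => leSI.
by have /eqP <- : I == S by rewrite eqEcard sIS.
Qed.

Lemma sum_incidence (R : realType) (I S : {set T}) :
  \sum_(e in S) incidence R I e = #|(I :&: S)%SET|%:R.
Proof.
rewrite -sum1_card natr_sum [RHS](eq_bigl (fun e => (e \in S) && (e \in I))).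
  by rewrite big_mkcondr; apply: eq_bigr => e _; rewrite ffunE; case: (e \in I).
by move=> e; rewrite inE andbC.
Qed.

(** The constraint indexed by [I] itself reads [#|I| <= rank M I], which forces
    independence; the constraint indexed by any other [S] counts the
    independent subset [I :&: S] of [S]. *)
Lemma incidence_indep_polytope (R : realType) (I : {set T}) :
  indep_polytope R M (incidence R I) <-> I \in indep M.
Proof.
split=> [[_ /(_ I)]|iI].
  by rewrite sum_incidence finset.setIid ler_nat; exact: indep_card_rank.
split=> [e|S]; first by rewrite ffunE ler0n.
rewrite sum_incidence ler_nat; apply: card_le_rank; last exact: finset.subsetIr.
by apply: indep_sub iI; exact: finset.subsetIl.
Qed.

Lemma indep_polytope_le1 (R : realType) (y : {ffun T -> R}) e :
  indep_polytope R M y -> y e <= 1.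
Proof.
move=> [_ /(_ [set e]%SET)]; rewrite finset.big_set1 => ye.
by apply: (le_trans ye); rewrite lern1 -(cards1 e) rank_le_card.
Qed.

End Rank.

(** * Direct sums *)

Section DirectSumPolytope.
Variables (J : finType) (T_ : J -> finType) (M : forall j, matroid (T_ j)).

Lemma sum_slices (R : realType) (S : {set {j : J & T_ j}})
    (f : {j : J & T_ j} -> R) :
  \sum_(v in S) f v = \sum_j \sum_(e in slice j S) f (Tagged T_ e).
Proof.
rewrite (sig_big_dep _ _ (fun j e => f (Tagged T_ e))) /=.
by apply: eq_big => [[j e]|[j e] _] //=; rewrite inE.
Qed.

Lemma slice_Tagged j (S : {set T_ j}) : slice j (Tagged T_ @: S)%SET = S.
Proof. by apply/setP => e; rewrite inE (mem_imset _ _ (@Tagged_inj _ _ j)). Qed.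

Lemma slice_Tagged_neq i j (S : {set T_ j}) :
  i != j -> slice i (Tagged T_ @: S)%SET = finset.set0.
Proof.
move=> neij; apply/setP => e; rewrite !inE; apply/imsetP => -[f _].
by move=> /(congr1 tag) /= eij; rewrite eij eqxx in neij.
Qed.

(** Bases of the slices of [S] glue to an independent subset of [S], and
    conversely the slices of a basis of [S] are independent. *)
Lemma rank_direct_sum (S : {set {j : J & T_ j}}) :
  rank (direct_sum M) S = (\sum_j rank (M j) (slice j S))%N.
Proof.
apply/eqP; rewrite eqn_leq; apply/andP; split.
  have [A [iA sAS <-]] := rank_basis (direct_sum M) S.
  rewrite card_slices; apply: leq_sum => j _; apply: card_le_rank.
    by move: iA; rewrite inE => /forallP.
  exact: slice_sub.
have /(_ _)/cid-/all_sig[B BP] := fun j => rank_basis (M j) (slice j S).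
pose A : {set {j : J & T_ j}} := [set v | tagged v \in B (tag v)]%SET.
have sliceA j : slice j A = B j by apply/setP => e; rewrite !inE.
have -> : (\sum_j rank (M j) (slice j S) = #|A|)%N.
  by rewrite card_slices; apply: eq_bigr => j _; rewrite sliceA; have [] := BP j.
apply: card_le_rank.
  by rewrite inE; apply/forallP => j; rewrite sliceA; have [] := BP j.
apply/fintype.subsetP => -[j e]; rewrite inE /= => eB.
have [_ /fintype.subsetP/(_ _ eB)] := BP j.
by rewrite inE.
Qed.

(** The independent set polytope of a direct sum is the product of those of the
    summands: a constraint of [M j] is the one of the sum indexed by a subset of
    the [j]-th component, and the constraint indexed by [S] is the sum of the
    constraints of the summands indexed by the slices of [S]. *)
Lemma indep_polytope_direct_sum (R : realType) (xi : {ffun {j : J & T_ j} -> R}) :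
  indep_polytope R (direct_sum M) xi <->
  forall j, indep_polytope R (M j) [ffun e => xi (Tagged T_ e)].
Proof.
split=> [[xi0 xiS] j|xiP].
  split=> [e|S]; first by rewrite ffunE.
  have rank0 i : rank (M i) finset.set0 = 0%N.
    by apply/eqP; rewrite -leqn0 (leq_trans (rank_le_card _ _)) ?cards0.
  have := xiS (Tagged T_ @: S)%SET; rewrite rank_direct_sum sum_slices.
  rewrite (bigD1 j) //= [X in _ <= X%:R](bigD1 j) //= slice_Tagged.
  rewrite [X in _ + X <= _]big1 => [|i nij]; last first.
    by rewrite slice_Tagged_neq // finset.big_set0.
  rewrite [X in (_ + X)%N]big1 => [|i nij]; last first.
    by rewrite slice_Tagged_neq // rank0.
  rewrite addr0 addn0; apply: le_trans.
  by under eq_bigr do rewrite ffunE.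
split=> [[j e]|S].
  by have [/(_ e)] := xiP j; rewrite ffunE.
rewrite rank_direct_sum sum_slices natr_sum; apply: ler_sum => j _.
have [_ /(_ (slice j S))] := xiP j.
by under eq_bigr do rewrite ffunE.
Qed.

End DirectSumPolytope.

(** * The occurrence region and its integral points *)

Section Occurrences.
Variables (R : realType) (E : finType) (m : nat) (G : 'I_m -> {set E}).
Variable M : forall j : 'I_m, matroid (local_ground G j).
Hypothesis Gcover : (\bigcup_j G j)%SET = [set: E]%SET.

Definition spread (y : {ffun E -> R}) : {ffun occurrence G -> R} :=
  [ffun v => y (occ_elt v)].

Lemma occurrence_exists e : exists v : occurrence G, occ_elt v = e.
Proof.
have : e \in (\bigcup_j G j)%SET by rewrite Gcover inE.
case/bigcupP => j _ eGj.
by exists (Tagged (local_ground G) (Sub e eGj : local_ground G j)).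
Qed.

Lemma spread_indep_polytope (y : {ffun E -> R}) :
  indep_polytope R (occurrence_matroid M) (spread y) <->
  forall j, indep_polytope R (M j) (restriction G j y).
Proof.
rewrite /occurrence_matroid indep_polytope_direct_sum.
have eqy j : [ffun e => spread y (Tagged (local_ground G) e)] =
             restriction G j y by apply/ffunP => e; rewrite !ffunE.
by split=> yP j; have := yP j; rewrite eqy.
Qed.

Lemma occurrence_regionP (y : {ffun E -> R}) (xi : {ffun occurrence G -> R}) :
  occurrence_region M R (y, xi) <-> xi = spread y /\ collection_polytope M R y.
Proof.
split=> [[/= xiS xiy xi0 y0]|[-> [y01 yP]]].
  have exi : xi = spread y by apply/ffunP => v; rewrite ffunE.
  split=> //; have xiP : indep_polytope R (occurrence_matroid M) xi by split.
  split; last by apply/spread_indep_polytope; rewrite -exi.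
  move=> e; rewrite y0 /=; have [v <-] := occurrence_exists e.
  by rewrite -xiy; exact: indep_polytope_le1 xiP.
have [xi0 xiS] := (spread_indep_polytope y).2 yP.
split=> //= [v|e]; first by rewrite ffunE.
by have /andP[] := y01 e.
Qed.

Lemma restriction_incidence j (I : {set E}) :
  restriction G j (incidence R I) = incidence R (trace G j I).
Proof. by apply/ffunP => e; rewrite !ffunE inE. Qed.

Lemma incidence_collection_polytope (I : {set E}) :
  collection_polytope M R (incidence R I) <-> I \in feasible_sets M.
Proof.
rewrite inE; split=> [[_ IP]|/forallP iI].
  apply/forallP => j; apply/(incidence_indep_polytope (M j) R).
  by rewrite -restriction_incidence.
split=> [e|j]; first by rewrite ffunE ler0n lern1 leq_b1.
by rewrite restriction_incidence; apply/incidence_indep_polytope.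
Qed.

Lemma integral_incidence (I : {set E}) : integral_vector (incidence R I).
Proof. by move=> e; rewrite ffunE; exact: rpred_nat. Qed.

Lemma integral_unit_incidence (x : {ffun E -> R}) :
  integral_vector x -> (forall e, 0 <= x e <= 1) -> exists I, x = incidence R I.
Proof.
move=> xZ x01; exists [set e | x e != 0]%SET; apply/ffunP => e.
rewrite ffunE inE; have [//|xe0] := eqVneq (x e) 0.
have /andP[x0 x1] := x01 e; apply/eqP; rewrite eq_le x1 /=.
(* A nonzero integer has absolute value at least one. *)
by rewrite -(ger0_norm x0); exact: norm_intr_ge1.
Qed.

Lemma integral_collection_polytope :
  (collection_polytope M R `&` integral_vector (T := E))%classic =
  [set incidence R I | I in [set I | I \in feasible_sets M]]%classic.
Proof.
apply/seteqP; split=> [x [xP xZ]|_ [I /= IF <-]].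
  have [I ex] := integral_unit_incidence xZ xP.1.
  by exists I => //=; apply/incidence_collection_polytope; rewrite -ex.
split; first exact/incidence_collection_polytope.
exact: integral_incidence.
Qed.

Lemma proj_feasible_occurrence_LP :
  [set z.1 | z in feasible (occurrence_LP R M)]%classic =
  collection_polytope M R.
Proof.
apply/seteqP; split=> [_ [[y xi] /occurrence_regionP[_ yP] <-]|y yP] //.
by exists (y, spread y) => //; apply/occurrence_regionP.
Qed.

Lemma proj_integral_occurrence_LP :
  [set z.1 | z in feasible (occurrence_LP R M) `&`
                  integral (occurrence_LP R M)]%classic =
  (collection_polytope M R `&` integral_vector (T := E))%classic.
Proof.
apply/seteqP; split=> [_ [[y xi] [/occurrence_regionP[_ yP] [yZ _]] <-]|y [yP yZ]].
  by split.
exists (y, spread y) => //; split; first exact/occurrence_regionP.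
by split=> //= v; rewrite ffunE.
Qed.

Lemma frac_opt_occurrence_LP w :
  frac_opt (occurrence_LP R M) w = frac_opt (polytope_formulation R M) w.
Proof.
by rewrite /frac_opt [feasible (polytope_formulation R M)]/=
  -proj_feasible_occurrence_LP image_comp.
Qed.

Lemma int_opt_occurrence_LP w :
  int_opt (occurrence_LP R M) w = int_opt (polytope_formulation R M) w.
Proof.
by rewrite /int_opt [feasible (polytope_formulation R M)]/=
  [integral (polytope_formulation R M)]/=
  -proj_integral_occurrence_LP image_comp.
Qed.

(** The gap of a formulation depends on its two optimum functions only. *)
Lemma integrality_gap_occurrence_LP :
  integrality_gap (occurrence_LP R M) =
  integrality_gap (polytope_formulation R M).
Proof.
rewrite /integrality_gap (funext frac_opt_occurrence_LP).
by rewrite (funext int_opt_occurrence_LP).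
Qed.

End Occurrences.

Theorem lemma5p1 (R : realType) (E : finType) (m p : nat)
    (G : 'I_m -> {set E}) (M : forall j : 'I_m, matroid (local_ground G j))
    (Gcover : (\bigcup_j G j)%SET = [set: E]%SET)
    (Gexact : forall e : E, #|[set j | e \in G j]%SET| = p)
    (Mloopless : forall (j : 'I_m) (e : local_ground G j), ~~ loop (M j) e) :
  [/\ [set z.1 | z in feasible (occurrence_LP R M)]%classic
        = collection_polytope M R,
      [set z.1 | z in feasible (occurrence_LP R M) `&`
                        integral (occurrence_LP R M)]%classic
        = [set incidence R I | I in [set I | I \in feasible_sets M]]%classic
    & (forall w : {ffun E -> R},
         frac_opt (occurrence_LP R M) w = frac_opt (polytope_formulation R M) w
         /\ int_opt (occurrence_LP R M) w = int_opt (polytope_formulation R M) w)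
      /\ integrality_gap (occurrence_LP R M)
           = integrality_gap (polytope_formulation R M)].
Proof.
split; first exact: proj_feasible_occurrence_LP.
  by rewrite proj_integral_occurrence_LP // integral_collection_polytope.
split; last exact: integrality_gap_occurrence_LP.
by move=> w; rewrite frac_opt_occurrence_LP // int_opt_occurrence_LP.
Qed.
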